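(* Consider a regular ladder with $m\ge2$ steps. Then there exist real constants $C_k$, $k\ge1$, and $\Lambda>0$ such that for all $\lambda\ge\Lambda$ $$E(\lambda)=H(\lambda)\lambda^\alpha e^\lambda-\left(\frac{\Delta_2}{\Delta_1}+H(\lambda)\lambda^\alpha\right)+\sum_{k=1}^{\infty}C_ke^{-k\lambda},$$ where the series converges uniformly on $[\Lambda,\infty)$.
   Context: Regular ladder: let $m\ge2$, $\Delta_1>0$, $\Delta_2\ge 0$ with $m\Delta_1+(m-1)\Delta_2=1$. Put $a_k=(k-1)(\Delta_1+\Delta_2)$, $b_k=a_k+\Delta_1$ for $k=1,\dots,m$ (so $a_1=0$, $b_m=1$), and $\rho_k=\frac1m$. The (regular generalized Cantor) ladder is the unique continuous function $C:[0,1]\to[0,1]$ with $C(0)=0$, $C(1)=1$ such that $C(t)=\frac{k-1}{m}+\frac1m C\big(\frac{t-a_k}{\Delta_1}\big)$ for $t\in[a_k,b_k]$, $1\le k\le m$, and $C(t)=\frac km$ for $t\in[b_k,a_{k+1}]$, $1\le k\le m-1$. It is monotone. (The function $C$ is not to be confused with the constants $C_k$.) For $\lambda\ge0$ let $E(\lambda)=\int_0^1e^{\lambda C(t)}\,dt$. Put $\alpha=\log_m(\Delta_1)<0$. The function $H$: put $f(\lambda)=E(m\lambda)-\Delta_1e^{(m-1)\lambda}E(\lambda)$, $f_1(\lambda)=\dfrac{f(\lambda)}{\Delta_1\lambda^\alpha e^{m\lambda}}$, and $H(\lambda)=\sum_{k\in\mathbb{Z}}f_1(m^k\lambda)$ for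 $\lambda>0$ (the series converges). Then $H(\lambda)=\Phi(\log_m\lambda)$ with $\Phi$ $1$-periodic; equivalently, $H$ is the unique function on $(0,\infty)$ of this form such that $E(\lambda)=H(\lambda)\lambda^\alpha e^\lambda+O(1)$ as $\lambda\to\infty$. *)

(* Defs.v *)
From Stdlib Require Export Reals.
From Coquelicot Require Export Coquelicot.
Open Scope R_scope.

Definition regular_params (m : nat) (D1 D2 : R) : Prop :=
  (2 <= m)%nat /\ 0 < D1 /\ 0 <= D2 /\ INR m * D1 + (INR m - 1) * D2 = 1.

Definition step_a (D1 D2 : R) (k : nat) : R := (INR k - 1) * (D1 + D2).
Definition step_b (D1 D2 : R) (k : nat) : R := step_a D1 D2 k + D1.

(* A function on [0,1] is encoded as a total function R -> R; nothing is assumed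
   about its values outside [0,1], and continuity is relative to [0,1]. *)
Definition regular_ladder (m : nat) (D1 D2 : R) (C : R -> R) : Prop :=
  continuous_on (fun t => 0 <= t <= 1) C /\
  (forall t, 0 <= t <= 1 -> 0 <= C t <= 1) /\
  C 0 = 0 /\ C 1 = 1 /\
  (forall (k : nat) (t : R), (1 <= k <= m)%nat ->
     step_a D1 D2 k <= t <= step_b D1 D2 k ->
     C t = (INR k - 1) / INR m + / INR m * C ((t - step_a D1 D2 k) / D1)) /\
  (forall (k : nat) (t : R), (1 <= k <= m - 1)%nat ->
     step_b D1 D2 k <= t <= step_a D1 D2 (S k) ->
     C t = INR k / INR m).

Definition E (C : R -> R) (l : R) : R := RInt (fun t => exp (l * C t)) 0 1.

Definition alpha (m : nat) (D1 : R) : R := ln D1 / ln (INR m).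

Definition f (m : nat) (D1 : R) (C : R -> R) (l : R) : R :=
  E C (INR m * l) - D1 * exp ((INR m - 1) * l) * E C l.

Definition f1 (m : nat) (D1 : R) (C : R -> R) (l : R) : R :=
  f m D1 C l / (D1 * Rpower l (alpha m D1) * exp (INR m * l)).

(* Sum over all of Z: indices 0, 1, 2, ... plus indices -1, -2, -3, ... *)
Definition ZSeries (u : Z -> R) : R :=
  Series (fun n : nat => u (Z.of_nat n)) +
  Series (fun n : nat => u (- Z.of_nat (S n))%Z).

Definition H (m : nat) (D1 : R) (C : R -> R) (l : R) : R :=
  ZSeries (fun k : Z => f1 m D1 C (powerRZ (INR m) k * l)).

(* Main.v *)
Require Import Defs.
From Stdlib Require Import Reals Lra Lia.
From Coquelicot Require Import Coquelicot.
Open Scope R_scope.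

(** Write [W l = E l / (e^l - 1)].  Self-similarity of [C] gives
    [W (m l) = D1 W l + D2 (1 / (e^l - 1) - 1 / (e^(m l) - 1))].  The inhomogeneous
    term is the sum of [D2 e^(-n l)] over the [n >= 1] not divisible by [m], so
    [-D2 * sum_n d_n e^(-n l)] with [d_(m n) = d_n / D1] and [d_n = 1 / D1] for [m]
    not dividing [n] is a particular solution.  Hence
    [reg l = W l + D2 * sum_n d_n e^(-n l)] satisfies [reg (m l) = D1 reg l], like
    [l^alpha].  On the other hand [f1 l = G (m l) - G l] with
    [G l = E l / (l^alpha e^l)], so the sum defining [H] telescopes to the limit of
    [G (m^n l)], which is [reg l / l^alpha].  Solving for [E l] and multiplying the
    series by [e^l - 1] gives the expansion, with [C_k = -D2 (d_(k+1) - d_k)]. *)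

(** * The coefficients [d_n] *)

Fixpoint coef_fuel (m : nat) (D1 : R) (fuel n : nat) : R :=
  match fuel with
  | O => 0
  | S p => / D1 * (if Nat.eqb (n mod m) 0 then coef_fuel m D1 p (n / m) else 1)
  end.

(* The solution of [d 0 = 0], [d (m * n) = d n / D1], [d n = 1 / D1] if m does
   not divide n. *)
Definition coef (m : nat) (D1 : R) (n : nat) : R := coef_fuel m D1 n n.

Lemma coef_fuel_0 (m : nat) (D1 : R) (p : nat) :
  (2 <= m)%nat -> coef_fuel m D1 p 0 = 0.
Proof.
intros Hm; induction p as [|p IH]; simpl; [easy|].
rewrite Nat.Div0.mod_0_l, Nat.Div0.div_0_l, IH; simpl; ring.
Qed.

(** Any fuel at least [n] is enough: a positive argument drops to [n / m < n], and at 0 every fuel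
    returns 0. *)
Lemma coef_fuel_stable (m : nat) (D1 : R) (p q n : nat) :
  (2 <= m)%nat -> (n <= p)%nat -> (n <= q)%nat ->
  coef_fuel m D1 p n = coef_fuel m D1 q n.
Proof.
intros Hm; revert q n; induction p as [|p IH]; intros q n Hp Hq.
- replace n with 0%nat by lia; now rewrite !coef_fuel_0.
- destruct (Nat.eq_dec n 0) as [->|Hn]; [now rewrite !coef_fuel_0|].
  destruct q as [|q]; [lia|]; simpl.
  assert (n / m < n)%nat by (apply Nat.div_lt; lia).
  now rewrite (IH q (n / m)%nat) by lia.
Qed.

Lemma coef_rec (m : nat) (D1 : R) (n : nat) :
  (2 <= m)%nat -> D1 <> 0 ->
  D1 * coef m D1 n = if Nat.eqb (n mod m) 0 then coef m D1 (n / m) else 1.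
Proof.
intros Hm HD; unfold coef; destruct n as [|n].
- rewrite Nat.Div0.mod_0_l, Nat.Div0.div_0_l; simpl; ring.
- assert (S n / m < S n)%nat by (apply Nat.div_lt; lia).
  rewrite (coef_fuel_stable m D1 (S n / m) n (S n / m)) by lia.
  cbn [coef_fuel]; now field.
Qed.

(** Each unit of fuel contributes at most one factor [/ D1 >= 1]. This is crude, but a bound
    exponential in [n] suffices because [Lambda] may be taken large. *)
Lemma coef_fuel_bound (m : nat) (D1 : R) (p n : nat) :
  0 < D1 <= 1 -> 0 <= coef_fuel m D1 p n <= (/ D1) ^ p.
Proof.
intros HD.
assert (H1 : 1 <= / D1) by (rewrite <- Rinv_1; apply Rinv_le_contravar; lra).
revert n; induction p as [|p IH]; intros n; simpl; [lra|].
assert (Hp := pow_R1_Rle _ p H1).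
destruct (Nat.eqb (n mod m) 0); [specialize (IH (n / m)%nat)|]; nra.
Qed.

(** * The power series with coefficients [d_n] *)

(** The partial sum up to [n] of the spread-out terms is the partial sum of [g] up to [n / m], and
    [n / m] tends to infinity. *)
Lemma is_series_dilate (m : nat) (g : nat -> R) (s : R) :
  (1 <= m)%nat -> is_series g s ->
  is_series (fun n => if Nat.eqb (n mod m) 0 then g (n / m)%nat else 0) s.
Proof.
intros Hm Hg.
assert (Hs : forall n,
  sum_n g (n / m) =
  sum_n (fun n => if Nat.eqb (n mod m) 0 then g (n / m)%nat else 0) n).
{ induction n as [|n IH].
  - now rewrite Nat.Div0.div_0_l, !sum_O, Nat.Div0.mod_0_l, Nat.Div0.div_0_l.
  - rewrite sum_Sn, <- IH.
    assert (Hn := Nat.div_mod_eq n m).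
    assert (Hr := Nat.mod_upper_bound n m ltac:(lia)).
    destruct (Nat.eq_dec (n mod m) (m - 1)) as [E1|E1].
    + assert (Hd : (S n / m = S (n / m))%nat)
        by (symmetry; apply Nat.div_unique with 0%nat; nia).
      assert (Hmod : (S n mod m = 0)%nat)
        by (symmetry; apply Nat.mod_unique with (S (n / m)); nia).
      now rewrite Hd, Hmod, sum_Sn.
    + assert (Hd : (S n / m = n / m)%nat)
        by (symmetry; apply Nat.div_unique with (S (n mod m)); nia).
      assert (Hmod : (S n mod m = S (n mod m))%nat)
        by (symmetry; apply Nat.mod_unique with (n / m)%nat; nia).
      rewrite Hd, Hmod; simpl; symmetry; apply Rplus_0_r. }
apply (is_lim_seq_ext _ _ (Finite s) Hs).
apply (is_lim_seq_subseq (sum_n g) s (fun n => (n / m)%nat)); [|exact Hg].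
intros P [N HN]; exists (N * m)%nat; intros n Hn; apply HN.
apply Nat.div_le_lower_bound; lia.
Qed.

Definition gen (m : nat) (D1 x : R) : R := Series (fun n => coef m D1 n * x ^ n).

(** Comparison with the geometric series of ratio [x / D1], whence the condition [x < D1]. *)
Lemma gen_correct (m : nat) (D1 x : R) :
  0 < D1 <= 1 -> 0 <= x < D1 ->
  is_series (fun n => coef m D1 n * x ^ n) (gen m D1 x).
Proof.
intros HD Hx; apply Series_correct.
apply (@ex_series_le R_AbsRing R_CompleteNormedModule _ (fun n => (x / D1) ^ n)).
- intros n; change norm with Rabs.
  destruct (coef_fuel_bound m D1 n n HD) as [H0 H1]; fold (coef m D1 n) in *.
  assert (Hxn := pow_le x n ltac:(lra)).
  rewrite Rabs_pos_eq by nra.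
  unfold Rdiv; rewrite Rpow_mult_distr; nra.
- apply ex_series_geom.
  assert (0 <= x / D1) by (apply Rle_mult_inv_pos; lra).
  rewrite Rabs_pos_eq by easy.
  apply Rmult_lt_reg_r with D1; [lra|]; field_simplify; lra.
Qed.

(** Termwise from [coef_rec]: the indices divisible by [m] regroup into [gen] at [x ^ m], and the
    others leave the geometric series in [x] minus the one in [x ^ m]. *)
Lemma gen_rec (m : nat) (D1 x : R) :
  (2 <= m)%nat -> 0 < D1 <= 1 -> 0 <= x < D1 ->
  D1 * gen m D1 x = / (1 - x) - / (1 - x ^ m) + gen m D1 (x ^ m).
Proof.
intros Hm HD Hx.
assert (Hxm : 0 <= x ^ m <= x).
{ destruct m as [|m]; [lia|]; simpl.
  assert (0 <= x ^ m) by (apply pow_le; lra).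
  assert (x ^ m <= 1) by (rewrite <- (pow1 m); apply pow_incr; lra); nra. }
assert (S1 := is_series_geom x ltac:(rewrite Rabs_pos_eq; lra)).
assert (S2 := is_series_dilate m _ _ ltac:(lia)
  (is_series_geom (x ^ m) ltac:(rewrite Rabs_pos_eq; lra))).
assert (S3 := is_series_dilate m _ _ ltac:(lia)
  (gen_correct m D1 (x ^ m) HD ltac:(lra))).
assert (S4 := is_series_plus _ _ _ _ (is_series_minus _ _ _ _ S1 S2) S3).
assert (S5 := is_series_scal D1 _ _ (gen_correct m D1 x HD Hx)).
rewrite <- (is_series_unique _ _ S5 : _ = D1 * gen m D1 x).
rewrite <- (is_series_unique _ _ S4 :
  _ = / (1 - x) - / (1 - x ^ m) + gen m D1 (x ^ m)).
apply Series_ext; intros n.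
change (D1 * (coef m D1 n * x ^ n) =
  x ^ n - (if Nat.eqb (n mod m) 0 then (x ^ m) ^ (n / m) else 0) +
  (if Nat.eqb (n mod m) 0 then coef m D1 (n / m) * (x ^ m) ^ (n / m) else 0)).
rewrite <- Rmult_assoc, coef_rec by (easy || lra).
destruct (Nat.eqb_spec (n mod m) 0) as [Hn|Hn]; [|ring].
rewrite <- pow_mult.
replace (m * (n / m))%nat with n by (rewrite (Nat.div_mod_eq n m) at 1; lia).
ring.
Qed.

Lemma gen_ge_0 (m : nat) (D1 x : R) :
  0 < D1 <= 1 -> 0 <= x < D1 -> 0 <= gen m D1 x.
Proof.
intros HD Hx.
(* Turns the left-hand 0 into a series of zero terms, so that [Series_le] applies. *)
rewrite <- (Rmult_0_l (Series (fun _ => 0))), <- Series_scal_l.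
apply Series_le; [|now exists (gen m D1 x); apply gen_correct].
intros n; assert (Hxn := pow_le x n ltac:(lra)).
assert (Hc := coef_fuel_bound m D1 n n HD); fold (coef m D1 n) in Hc; nra.
Qed.

(** The series has no constant term, and [c ^ n <= c] for [n >= 1]. *)
Lemma gen_mul_le (m : nat) (D1 x c : R) :
  0 < D1 <= 1 -> 0 <= x < D1 -> 0 <= c <= 1 ->
  gen m D1 (c * x) <= c * gen m D1 x.
Proof.
intros HD Hx Hc; unfold gen; rewrite <- Series_scal_l.
apply Series_le.
- intros n; assert (Hxn := pow_le x n ltac:(lra)).
  assert (Hcn := pow_le c n ltac:(lra)).
  assert (H0 := coef_fuel_bound m D1 n n HD); fold (coef m D1 n) in H0.
  rewrite Rpow_mult_distr.
  assert (Hp : 0 <= coef m D1 n * x ^ n) by nra.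
  split; [nra|].
  destruct n as [|n]; [unfold coef; simpl; lra|].
  assert (c ^ S n <= c).
  { simpl; assert (c ^ n <= 1) by (rewrite <- (pow1 n); apply pow_incr; lra); nra. }
  nra.
- exists (c * gen m D1 x).
  now apply (is_series_scal c (fun n => coef m D1 n * x ^ n)), gen_correct.
Qed.

(** Dividing by [x] shifts the coefficients, so [/ x - 1] replaces them by their differences. The
    term of index 0 is [d_1 - d_0 = / D1]; it is split off and becomes the constant [D2 / D1] of the
    expansion. *)
Lemma gen_diff (m : nat) (D1 x : R) :
  (2 <= m)%nat -> 0 < D1 <= 1 -> 0 < x < D1 ->
  is_series (fun j => (coef m D1 (S (S j)) - coef m D1 (S j)) * x ^ S j)
    ((/ x - 1) * gen m D1 x - / D1).
Proof.
intros Hm HD Hx.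
assert (S1 := gen_correct m D1 x HD ltac:(lra)).
assert (c1 : coef m D1 1 = / D1).
{ unfold coef; cbn [coef_fuel]; rewrite Nat.mod_small by lia; simpl; ring. }
assert (S2 : is_series (fun n => coef m D1 (S n) * x ^ S n) (gen m D1 x)).
{ apply (is_series_incr_1 (fun n => coef m D1 n * x ^ n)).
  assert (e : gen m D1 x + coef m D1 0 * x ^ 0 = gen m D1 x)
    by (unfold coef; simpl; ring).
  rewrite <- e in S1 at 1; exact S1. }
assert (S3 := is_series_minus _ _ _ _ (is_series_scal (/ x) _ _ S2) S1).
apply (is_series_incr_1
  (fun j => (coef m D1 (S j) - coef m D1 j) * x ^ j)).
assert (c0 : coef m D1 0 = 0) by easy.
assert (e : / x * gen m D1 x + - gen m D1 x =
  (/ x - 1) * gen m D1 x - / D1 + (coef m D1 1 - coef m D1 0) * x ^ 0)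
  by (rewrite c0, c1; ring).
change (is_series (fun j => (coef m D1 (S j) - coef m D1 j) * x ^ j)
  ((/ x - 1) * gen m D1 x - / D1 + (coef m D1 1 - coef m D1 0) * x ^ 0)).
rewrite <- e.
eapply is_series_ext; [|exact S3]; intros n.
unfold plus, scal, opp; simpl; unfold mult; simpl; field; lra.
Qed.

(** * Auxiliary analysis: uniform convergence, integrability, telescoping, exponentials *)

(** Weierstrass M-test: blocks of the series are dominated, uniformly in [x], by blocks of the
    series of [M], so the partial sums are uniformly Cauchy. *)
Lemma CVU_dom_M_test (u : nat -> R -> R) (M : nat -> R) (D : R -> Prop) :
  ex_series M -> (forall n x, D x -> Rabs (u n x) <= M n) ->
  CVU_dom (fun n x => sum_n (fun j => u j x) n) D.
Proof.
intros HM Hu; apply CVU_dom_cauchy; intros eps.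
destruct (Cauchy_ex_series _ HM eps) as [N HN].
assert (W : forall n p x, D x -> (N <= n)%nat -> (n <= p)%nat ->
  Rabs (sum_n (fun j => u j x) n - sum_n (fun j => u j x) p) < eps).
{ intros n p x Hx Hn Hp.
  rewrite Rabs_minus_sym.
  destruct (Nat.eq_dec n p) as [<-|Hne].
  - rewrite Rminus_diag, Rabs_R0; apply eps.
  - assert (e : sum_n_m (fun j => u j x) (S n) p =
      sum_n (fun j => u j x) p - sum_n (fun j => u j x) n)
      by exact (sum_n_m_sum_n (fun j => u j x) n p Hp).
    rewrite <- e.
    eapply Rle_lt_trans; [apply (norm_sum_n_m (fun j => u j x))|].
    eapply Rle_lt_trans; [|apply (HN (S n) p); lia].
    eapply Rle_trans; [|apply Rle_abs].
    apply sum_n_m_le; intros k; now apply Hu. }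
exists N; intros n p x Hx Hn Hp.
destruct (Nat.le_ge_cases n p); [now apply W|].
rewrite Rabs_minus_sym; now apply W.
Qed.

(** Nothing is known about [h] outside [[a, b]]. Composing it with the 1-Lipschitz retraction onto
    [[a, b]] gives an everywhere continuous function with the same values there. *)
Lemma ex_RInt_continuous_on (h : R -> R) (a b : R) :
  a <= b -> continuous_on (fun t => a <= t <= b) h -> ex_RInt h a b.
Proof.
intros Hab Hh.
pose (clamp := fun t => Rmax a (Rmin b t)).
assert (Hcl : forall t, a <= clamp t <= b)
  by (intros t; unfold clamp, Rmax, Rmin; repeat destruct Rle_dec; lra).
assert (Hlip : forall s t, Rabs (clamp s - clamp t) <= Rabs (s - t)).
{ intros s t; unfold clamp, Rmax, Rmin; repeat destruct Rle_dec;
    unfold Rabs; repeat destruct Rcase_abs; lra. }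
apply (ex_RInt_ext (fun t => h (clamp t))).
{ intros t; rewrite Rmin_left, Rmax_right by easy; intros Ht.
  f_equal; unfold clamp; rewrite Rmin_right, Rmax_right; lra. }
apply (ex_RInt_continuous (V := R_CompleteNormedModule)); intros z _.
apply filterlim_locally; intros eps.
destruct (proj1 (filterlim_locally _ _) (Hh _ (Hcl z)) eps) as [d Hd].
exists d; intros y Hy; apply Hd; [|apply Hcl].
eapply Rle_lt_trans; [apply Hlip|exact Hy].
Qed.

Lemma is_series_telescope (g : nat -> R) (s : R) :
  is_lim_seq g s -> is_series (fun n => g (S n) - g n) (s - g 0%nat).
Proof.
intros Hg.
assert (Hs : forall n, g (S n) - g 0%nat = sum_n (fun n => g (S n) - g n) n).
{ induction n as [|n IH]; [now rewrite sum_O|].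
  rewrite sum_Sn, <- IH; unfold plus; simpl; ring. }
apply (is_lim_seq_ext _ _ (Finite (s - g 0%nat)) Hs).
apply is_lim_seq_minus'; [now apply (is_lim_seq_incr_1 g)|].
apply is_lim_seq_const.
Qed.

Lemma exp_mult_pow (x : R) (n : nat) : exp (INR n * x) = exp x ^ n.
Proof.
induction n as [|n IH]; [simpl; now rewrite Rmult_0_l, exp_0|].
rewrite S_INR, Rmult_plus_distr_r, Rmult_1_l, exp_plus, IH; simpl; ring.
Qed.

Lemma exp_gt_1 (l : R) : 0 < l -> 1 < exp l.
Proof. intros Hl; rewrite <- exp_0; now apply exp_increasing. Qed.

Lemma exp_le_compat (x y : R) : x <= y -> exp x <= exp y.
Proof. intros [Hxy|<-]; [now apply Rlt_le, exp_increasing|lra]. Qed.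

(** * The functional equation of [E] *)

Section Ladder.

Context (m : nat) (D1 D2 : R) (C : R -> R).
Context (hpar : regular_params m D1 D2) (hC : regular_ladder m D1 D2 C).

Lemma m_ge_2 : 2 <= INR m.
Proof. destruct hpar as [Hm _]; now apply (le_INR 2). Qed.

Lemma D1_lt_1 : 0 < D1 < 1.
Proof. destruct hpar as (Hm & H1 & H2 & H3); assert (Hm2 := m_ge_2); nra. Qed.

Lemma ex_RInt_exp_ladder (l a b : R) :
  0 <= a <= b -> b <= 1 -> ex_RInt (fun t => exp (l * C t)) a b.
Proof.
intros Ha Hb; apply ex_RInt_continuous_on; [lra|].
intros x Hx; destruct hC as [Hc _].
apply (filterlim_comp _ _ _ C (fun y => exp (l * y)) _ (locally (C x))).
- eapply filterlim_filter_le_1; [|apply (Hc x); lra].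
  intros P [d Hd]; exists d; intros y Hy Hyab; apply Hd; [easy|lra].
- apply (ex_derive_continuous (fun y => exp (l * y))); now auto_derive.
Qed.

Lemma RInt_exp_ladder_Chasles (l b c : R) :
  0 <= b <= c -> c <= 1 ->
  RInt (fun t => exp (l * C t)) 0 b + RInt (fun t => exp (l * C t)) b c =
  RInt (fun t => exp (l * C t)) 0 c.
Proof.
intros Hb Hc.
apply (RInt_Chasles (fun t => exp (l * C t))); apply ex_RInt_exp_ladder; lra.
Qed.

(** The affine substitution sending the step onto [[0, 1]] contributes [D1]; self-similarity turns
    [m l C] into [(k - 1) l + l C]. *)
Lemma RInt_rise (l : R) (k : nat) :
  (1 <= k <= m)%nat ->
  RInt (fun t => exp (INR m * l * C t)) (step_a D1 D2 k) (step_b D1 D2 k) =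
  D1 * exp ((INR k - 1) * l) * E C l.
Proof.
intros Hk.
assert (HD := D1_lt_1); assert (Hm := m_ge_2).
destruct hC as (_ & _ & _ & _ & HC & _).
pose (g := fun t => exp (l * C t)).
assert (e0 : / D1 * step_a D1 D2 k + - step_a D1 D2 k / D1 = 0) by (field; lra).
assert (e1 : / D1 * step_b D1 D2 k + - step_a D1 D2 k / D1 = 1)
  by (unfold step_b; field; lra).
assert (Hex : ex_RInt g (/ D1 * step_a D1 D2 k + - step_a D1 D2 k / D1)
  (/ D1 * step_b D1 D2 k + - step_a D1 D2 k / D1))
  by (rewrite e0, e1; apply ex_RInt_exp_ladder; lra).
assert (Hsub := RInt_comp_lin _ _ _ _ _ Hex); rewrite e0, e1 in Hsub.
unfold E; fold g; rewrite <- Hsub.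
etransitivity;
  [|exact (RInt_scal _ _ _ (D1 * exp ((INR k - 1) * l))
      (ex_RInt_comp_lin _ _ _ _ _ Hex))].
apply RInt_ext; intros t.
rewrite Rmin_left, Rmax_right by (unfold step_b; lra); intros Ht.
rewrite (HC k t) by (easy || lra); unfold g.
replace (/ D1 * t + - step_a D1 D2 k / D1) with ((t - step_a D1 D2 k) / D1)
  by (field; lra).
set (c := C _).
replace (INR m * l * ((INR k - 1) / INR m + / INR m * c))
  with ((INR k - 1) * l + l * c) by (field; lra).
rewrite exp_plus; unfold scal; simpl; unfold mult; simpl; field; lra.
Qed.

Lemma RInt_flat (l : R) (k : nat) :
  (1 <= k <= m - 1)%nat ->
  RInt (fun t => exp (INR m * l * C t)) (step_b D1 D2 k) (step_a D1 D2 (S k)) =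
  D2 * exp (INR k * l).
Proof.
intros Hk.
assert (HD := hpar); destruct HD as (_ & HD1 & HD2 & _); assert (Hm := m_ge_2).
destruct hC as (_ & _ & _ & _ & _ & HC).
assert (Hlen : step_a D1 D2 (S k) - step_b D1 D2 k = D2)
  by (unfold step_b, step_a; rewrite S_INR; ring).
rewrite (RInt_ext _ (fun _ => exp (INR k * l))).
- rewrite RInt_const, Hlen; reflexivity.
- intros t; rewrite Rmin_left, Rmax_right by lra; intros Ht.
  rewrite (HC k t) by (easy || lra); f_equal; field; lra.
Qed.

(** The first [k] rises and flats add up to [D1 E(l) + D2 e^l] times the geometric sum of [e^(i l)]
    for [i < k]. Multiplying by [e^l - 1] sums it without division, so [l = 0] needs no special
    treatment. *)
Lemma RInt_steps (l : R) (k : nat) :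
  (k <= m - 1)%nat ->
  (exp l - 1) * RInt (fun t => exp (INR m * l * C t)) 0 (step_a D1 D2 (S k)) =
  (D1 * E C l + D2 * exp l) * (exp (INR k * l) - 1).
Proof.
assert (HD := hpar); destruct HD as (Hm & HD1 & HD2 & Hsum).
assert (Hm2 := m_ge_2).
induction k as [|k IH]; intros Hk.
- replace (step_a D1 D2 1) with 0 by (unfold step_a; simpl; ring).
  rewrite RInt_point; simpl INR; rewrite Rmult_0_l, exp_0.
  unfold zero; simpl; ring.
- assert (HkR : INR (S (S k)) <= INR m) by (apply le_INR; lia).
  rewrite !S_INR in HkR; assert (Hk0 := pos_INR k).
  assert (Ha : 0 <= step_a D1 D2 (S k))
    by (unfold step_a; rewrite S_INR; nra).
  assert (Hab : step_b D1 D2 (S k) = step_a D1 D2 (S k) + D1) by easy.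
  assert (Hba : step_a D1 D2 (S (S k)) = step_b D1 D2 (S k) + D2)
    by (unfold step_b, step_a; rewrite !S_INR; ring).
  (* With 1 expanded by the parameter relation, the gap is [(m - k - 2) (D1 + D2) + D1]. *)
  assert (H1 : step_a D1 D2 (S (S k)) <= 1)
    by (unfold step_a; rewrite !S_INR;
        assert (Hp := Rmult_le_pos (INR m - INR k - 2) (D1 + D2)
          ltac:(lra) ltac:(lra)); lra).
  assert (X1 := RInt_exp_ladder_Chasles (INR m * l)
    (step_a D1 D2 (S k)) (step_b D1 D2 (S k))
    ltac:(lra) ltac:(lra)).
  assert (X2 := RInt_exp_ladder_Chasles (INR m * l)
    (step_b D1 D2 (S k)) (step_a D1 D2 (S (S k)))
    ltac:(lra) ltac:(lra)).
  rewrite RInt_rise in X1 by lia; rewrite RInt_flat in X2 by lia.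
  rewrite <- X2, <- X1.
  rewrite !Rmult_plus_distr_l, IH by lia.
  rewrite !S_INR; replace (INR k + 1 - 1) with (INR k) by ring.
  rewrite (Rmult_plus_distr_r (INR k) 1 l), Rmult_1_l, exp_plus; ring.
Qed.

(** The interval consists of [m - 1] rise-and-flat pairs and a last rise, which has no flat after
    it. *)
Lemma E_functional (l : R) :
  (exp l - 1) * E C (INR m * l) =
  D1 * E C l * (exp (INR m * l) - 1) + D2 * (exp (INR m * l) - exp l).
Proof.
assert (HD := hpar); destruct HD as (Hm & HD1 & HD2 & Hsum).
assert (Hm2 := m_ge_2).
assert (Hs := RInt_steps l (m - 1) ltac:(lia)).
replace (S (m - 1)) with m in Hs by lia.
rewrite minus_INR in Hs by lia; simpl (INR 1) in Hs.
assert (Hb : step_b D1 D2 m = 1) by (unfold step_b, step_a; lra).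
assert (Ha : 0 <= step_a D1 D2 m) by (unfold step_a; nra).
assert (Hab : step_b D1 D2 m = step_a D1 D2 m + D1) by easy.
assert (X1 := RInt_exp_ladder_Chasles (INR m * l)
    (step_a D1 D2 m) (step_b D1 D2 m)
    ltac:(lra) ltac:(lra)).
rewrite RInt_rise in X1 by lia; rewrite Hb in X1.
unfold E at 1; rewrite <- X1.
rewrite Rmult_plus_distr_l, Hs.
replace (INR m * l) with ((INR m - 1) * l + l) by ring.
rewrite (exp_plus _ l); ring.
Qed.

Lemma E_bounds (l : R) : 0 <= l -> 0 <= E C l <= exp l.
Proof.
intros Hl; destruct hC as (_ & HC & _).
assert (Hex := ex_RInt_exp_ladder l 0 1 ltac:(lra) ltac:(lra)).
split.
- apply RInt_ge_0; [lra|easy|]; intros; apply Rlt_le, exp_pos.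
- replace (exp l) with (RInt (fun _ => exp l) 0 1)
    by (rewrite RInt_const; unfold scal; simpl; unfold mult; simpl; ring).
  apply RInt_le; [lra|easy|apply ex_RInt_const|].
  intros t Ht; specialize (HC t ltac:(lra)).
  apply exp_le_compat; nra.
Qed.

(** * Scaling of [reg] and [G], and the value of [H] *)

Definition reg (l : R) : R := E C l / (exp l - 1) + D2 * gen m D1 (exp (- l)).

Definition G (l : R) : R := E C l / (Rpower l (alpha m D1) * exp l).

(** For [x = e^(-l)] one has [1 / (1 - x) = 1 + 1 / (e^l - 1)], so the inhomogeneous terms of
    [gen_rec] and [E_functional] cancel. *)
Lemma reg_mul (l : R) :
  0 < l -> exp (- l) < D1 -> reg (INR m * l) = D1 * reg l.
Proof.
intros Hl HlD; assert (Hm := m_ge_2); assert (HD := D1_lt_1).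
assert (Hu := exp_gt_1 l Hl).
assert (Hv := exp_gt_1 (INR m * l) ltac:(nra)).
assert (HE := E_functional l).
assert (Hx := exp_pos (- l)).
assert (Hg := gen_rec m D1 (exp (- l)) (proj1 hpar) ltac:(lra) ltac:(lra)).
rewrite <- exp_mult_pow in Hg.
replace (INR m * - l) with (- (INR m * l)) in Hg by ring.
unfold reg; rewrite !exp_Ropp in *.
set (u := exp l) in *; set (v := exp (INR m * l)) in *.
replace (gen m D1 (/ v))
  with (D1 * gen m D1 (/ u) - / (1 - / u) + / (1 - / v)) by (rewrite Hg; ring).
replace (E C (INR m * l)) with ((D1 * E C l * (v - 1) + D2 * (v - u)) / (u - 1))
  by (rewrite <- HE; field; lra).
field; lra.
Qed.

Lemma Rpower_scale (l : R) (n : nat) :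
  0 < l -> Rpower (INR m ^ n * l) (alpha m D1) = D1 ^ n * Rpower l (alpha m D1).
Proof.
intros Hl; assert (Hm := m_ge_2); assert (HD := D1_lt_1).
assert (e : Rpower (INR m) (alpha m D1) = D1).
{ assert (0 < ln (INR m)) by (rewrite <- ln_1; apply ln_increasing; lra).
  unfold Rpower, alpha; replace (ln D1 / ln (INR m) * ln (INR m)) with (ln D1)
    by (field; lra).
  apply exp_ln; lra. }
induction n as [|n IH]; [now rewrite !pow_O, !Rmult_1_l|].
assert (Hp : 0 < INR m ^ n) by (apply pow_lt; lra).
simpl; rewrite Rmult_assoc, <- Rpower_mult_distr, e, IH by nra; ring.
Qed.

(** Since [m^alpha = D1], the denominator of [f1] is [(m l)^alpha e^(m l)]; in the second term of
    [f] the factor [D1 e^((m - 1) l)] reduces it to that of [G l]. *)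
Lemma f1_diff (l : R) : 0 < l -> f1 m D1 C l = G (INR m * l) - G l.
Proof.
intros Hl; assert (HD := D1_lt_1).
assert (Hs := Rpower_scale l 1 Hl); rewrite !pow_1 in Hs.
unfold f1, Defs.f, G; rewrite Hs.
replace (INR m * l) with ((INR m - 1) * l + l) by ring.
rewrite exp_plus.
assert (H1 := exp_pos l); assert (H2 := exp_pos ((INR m - 1) * l)).
assert (H3 : 0 < Rpower l (alpha m D1)) by apply exp_pos.
field; lra.
Qed.

Lemma G_bounds (l : R) : 0 <= l -> 0 <= G l <= / Rpower l (alpha m D1).
Proof.
intros Hl; assert (HE := E_bounds l Hl); assert (H1 := exp_pos l).
assert (H3 : 0 < Rpower l (alpha m D1)) by apply exp_pos.
unfold G; split; [apply Rle_mult_inv_pos; nra|].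
apply Rmult_le_reg_r with (Rpower l (alpha m D1) * exp l); [nra|].
field_simplify; lra.
Qed.

(** Both halves of the sum over Z telescope: the nonnegative indices give [h - G l], the negative
    ones [G l], because [G (m^(-n) l)] is at most [D1^n / l^alpha] and so tends to 0. *)
Lemma H_limit (l h : R) :
  0 < l -> is_lim_seq (fun n => G (INR m ^ n * l)) h -> H m D1 C l = h.
Proof.
intros Hl Hlim; assert (Hm := m_ge_2); assert (HD := D1_lt_1).
assert (Hpos : forall n, 0 < INR m ^ n) by (intros; apply pow_lt; lra).
assert (Hpos' : forall n, 0 < / INR m ^ n * l)
  by (intros n; assert (Hi := Rinv_0_lt_compat _ (Hpos n)); nra).
(* The minus sign makes the increments of this sequence the terms of [H] at the indices
   [-(n + 1)]. *)
assert (Hlim0 : is_lim_seq (fun n => - G (/ INR m ^ n * l)) 0).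
{ replace 0 with (- 0) by ring; apply (proj1 (is_lim_seq_opp _ 0)).
  apply is_lim_seq_le_le with (fun _ => 0)
    (fun n => / Rpower l (alpha m D1) * D1 ^ n).
  - intros n; assert (Hb := G_bounds _ (Rlt_le _ _ (Hpos' n))).
    split; [easy|]; eapply Rle_trans; [apply Hb|]; right.
    assert (Hs := Rpower_scale _ n (Hpos' n)).
    assert (H3 : 0 < Rpower (/ INR m ^ n * l) (alpha m D1)) by apply exp_pos.
    rewrite <- Rmult_assoc, Rinv_r, Rmult_1_l in Hs by apply Rgt_not_eq, Hpos.
    rewrite Hs; assert (0 < D1 ^ n) by (apply pow_lt; lra).
    field; lra.
  - apply is_lim_seq_const.
  - replace 0 with (/ Rpower l (alpha m D1) * 0) by ring.
    apply (is_lim_seq_scal_l _ _ (Finite 0)), is_lim_seq_geom.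
    rewrite Rabs_pos_eq; lra. }
assert (S1 := is_series_unique _ _ (is_series_telescope _ _ Hlim)).
assert (S2 := is_series_unique _ _ (is_series_telescope _ _ Hlim0)).
cbv beta in S1, S2; rewrite !pow_O, Rinv_1, Rmult_1_l in *.
unfold H, ZSeries; replace h with ((h - G l) + (0 - - G l)) by ring.
rewrite <- S1, <- S2; f_equal; apply Series_ext; intros n.
- rewrite <- pow_powerRZ, f1_diff by (apply Rmult_lt_0_compat; auto).
  simpl; now rewrite Rmult_assoc.
- replace (powerRZ (INR m) (- Z.of_nat (S n))) with (/ INR m ^ S n)
    by (rewrite powerRZ_neg', <- pow_powerRZ; reflexivity).
  rewrite f1_diff by apply Hpos'.
  replace (INR m * (/ INR m ^ S n * l)) with (/ INR m ^ n * l)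
    by (assert (Hp := Hpos n); simpl; field; lra).
  ring.
Qed.

Lemma scale_ge (l : R) (n : nat) : 0 <= l -> l <= INR m ^ n * l.
Proof.
intros Hl; assert (Hm := m_ge_2).
assert (1 <= INR m ^ n) by (apply pow_R1_Rle; lra); nra.
Qed.

(** Passing from [x] to [m x] multiplies [e^(-x)] by [e^(-(m - 1) x)], at most [e^(-l)], and
    [gen_mul_le] applies. The rate lies strictly below [D1], so the decay survives division by
    [D1 ^ n] in [G_limit]. *)
Lemma gen_decay (l : R) (n : nat) :
  1 <= l -> exp (- l) <= exp (-1) * D1 ->
  gen m D1 (exp (- (INR m ^ n * l))) <= (exp (-1) * D1) ^ n * gen m D1 (exp (- l)).
Proof.
intros Hl HlD; assert (Hm := m_ge_2); assert (HD := D1_lt_1).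
assert (He : exp (-1) < 1) by (rewrite <- exp_0; apply exp_increasing; lra).
assert (He0 := exp_pos (-1)).
induction n as [|n IH]; [rewrite !pow_O, !Rmult_1_l; lra|].
assert (Hs := scale_ge l n ltac:(lra)).
set (x := INR m ^ n * l) in *.
replace (INR m ^ S n * l) with ((INR m - 1) * x + x)
  by (unfold x; simpl; ring).
rewrite Ropp_plus_distr, exp_plus.
assert (Hx := exp_pos (- x)); assert (Hc := exp_pos (- ((INR m - 1) * x))).
assert (exp (- x) <= exp (- l)) by (apply exp_le_compat; lra).
assert (exp (- ((INR m - 1) * x)) <= exp (- l)) by (apply exp_le_compat; nra).
eapply Rle_trans; [apply gen_mul_le; nra|].
assert (Hg := gen_ge_0 m D1 (exp (- x)) ltac:(lra) ltac:(nra)).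
simpl; rewrite Rmult_assoc.
apply Rmult_le_compat; lra.
Qed.

(** One has [G l = (1 - e^(-l)) (reg l - D2 gen (e^(-l))) / l^alpha]. Along [m^n l] both [reg] and
    [l^alpha] scale by [D1^n], while the two corrections vanish in the limit. *)
Lemma G_limit (l : R) :
  1 <= l -> exp (- l) <= exp (-1) * D1 ->
  is_lim_seq (fun n => G (INR m ^ n * l)) (reg l / Rpower l (alpha m D1)).
Proof.
intros Hl HlD; assert (Hm := m_ge_2); assert (HD := D1_lt_1).
assert (He : exp (-1) < 1) by (rewrite <- exp_0; apply exp_increasing; lra).
assert (He0 := exp_pos (-1)).
assert (H3 : 0 < Rpower l (alpha m D1)) by apply exp_pos.
assert (Hgeom : is_lim_seq (fun n => exp (-1) ^ n) 0)
  by (apply is_lim_seq_geom; rewrite Rabs_pos_eq; lra).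
assert (Hreg : forall n, reg (INR m ^ n * l) = D1 ^ n * reg l).
{ induction n as [|n IH]; [now rewrite !pow_O, !Rmult_1_l|].
  assert (Hs := scale_ge l n ltac:(lra)).
  assert (exp (- (INR m ^ n * l)) <= exp (- l)) by (apply exp_le_compat; lra).
  simpl; rewrite Rmult_assoc, reg_mul, IH by nra; ring. }
assert (Hexp : is_lim_seq (fun n => exp (- (INR m ^ n * l))) 0).
{ apply is_lim_seq_le_le with (fun _ => 0) (fun n => exp (-1) ^ n);
    [|apply is_lim_seq_const|easy].
  intros n; split; [apply Rlt_le, exp_pos|].
  rewrite <- exp_mult_pow; apply exp_le_compat.
  (* Bernoulli's inequality yields [n <= m^n], hence [n <= m^n l]. *)
  assert (Hb := poly n (INR m - 1) ltac:(lra)).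
  replace (1 + (INR m - 1)) with (INR m) in Hb by ring.
  assert (Hn := pos_INR n).
  assert (INR n <= INR m ^ n) by nra; nra. }
assert (Hgen : is_lim_seq (fun n => gen m D1 (exp (- (INR m ^ n * l))) / D1 ^ n) 0).
{ apply is_lim_seq_le_le
    with (fun _ => 0) (fun n => gen m D1 (exp (- l)) * exp (-1) ^ n).
  - intros n; assert (Hn : 0 < D1 ^ n) by (apply pow_lt; lra).
    assert (Hs := scale_ge l n ltac:(lra)).
    assert (exp (- (INR m ^ n * l)) <= exp (- l)) by (apply exp_le_compat; lra).
    assert (Hx := exp_pos (- (INR m ^ n * l))).
    split.
    + apply Rle_mult_inv_pos; [apply gen_ge_0; nra|easy].
    + apply Rmult_le_reg_r with (D1 ^ n); [easy|].
      assert (Hd := gen_decay l n Hl HlD); rewrite Rpow_mult_distr in Hd.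
      field_simplify; lra.
  - apply is_lim_seq_const.
  - replace 0 with (gen m D1 (exp (- l)) * 0) by ring.
    now apply (is_lim_seq_scal_l _ _ (Finite 0)). }
apply is_lim_seq_ext with (fun n => (1 - exp (- (INR m ^ n * l))) *
  (reg l / Rpower l (alpha m D1) - D2 / Rpower l (alpha m D1) *
    (gen m D1 (exp (- (INR m ^ n * l))) / D1 ^ n))).
- intros n.
  assert (Hs := scale_ge l n ltac:(lra)).
  assert (Hn : 0 < D1 ^ n) by (apply pow_lt; lra).
  specialize (Hreg n); unfold reg at 1 in Hreg.
  assert (Hu := exp_gt_1 (INR m ^ n * l) ltac:(lra)).
  unfold G; rewrite Rpower_scale by lra.
  replace (reg l) with (D1 ^ n * reg l / D1 ^ n) by (field; lra).
  rewrite <- Hreg, exp_Ropp; field; lra.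
- set (c := reg l / _); set (d := D2 / _).
  replace (Finite c) with (Finite ((1 - 0) * (c - d * 0))) by (f_equal; ring).
  apply is_lim_seq_mult'; apply is_lim_seq_minus'; try apply is_lim_seq_const.
  + easy.
  + now apply (is_lim_seq_scal_l _ _ (Finite 0)).
Qed.

End Ladder.

(** * The expansion of [E] *)

Theorem theorem4 (m : nat) (D1 D2 : R) (C : R -> R)
  (hpar : regular_params m D1 D2) (hC : regular_ladder m D1 D2 C) :
  exists (Ck : nat -> R) (L : R),
    0 < L /\
    (forall l : R, L <= l ->
       E C l =
         H m D1 C l * Rpower l (alpha m D1) * exp l
         - (D2 / D1 + H m D1 C l * Rpower l (alpha m D1))
         + Series (fun j : nat => Ck (S j) * exp (- INR (S j) * l))) /\
    CVU_dom
      (fun (n : nat) (l : R) =>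
         sum_n (fun j : nat => Ck (S j) * exp (- INR (S j) * l)) n)
      (fun l : R => L <= l).
Proof.
assert (HD := D1_lt_1 m D1 D2 hpar).
assert (Hln : ln D1 < 0) by (rewrite <- ln_1; apply ln_increasing; lra).
assert (He : exp (-1) < 1) by (rewrite <- exp_0; apply exp_increasing; lra).
assert (He0 := exp_pos (-1)).
(* The threshold [1 - ln D1] is where [e^(-l) = e^(-1) D1]: beyond it [e^(-l) / D1] is at most
   [e^(-1)], which leaves room for a geometric majorant. *)
assert (HL : forall l, 1 - ln D1 <= l -> exp (- l) <= exp (-1) * D1).
{ intros l Hl; rewrite <- (exp_ln D1) at 1 by lra; rewrite <- exp_plus.
  apply exp_le_compat; lra. }
assert (Hpow : forall j l, exp (- INR (S j) * l) = exp (- l) ^ S j)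
  by (intros j l; rewrite <- exp_mult_pow; f_equal; ring).
exists (fun k => - D2 * (coef m D1 (S k) - coef m D1 k)), (1 - ln D1).
split; [lra|split].
- intros l Hl; specialize (HL l Hl).
  assert (HH := H_limit m D1 D2 C hpar hC l _ ltac:(lra)
    (G_limit m D1 D2 C hpar hC l ltac:(lra) HL)).
  assert (H3 : 0 < Rpower l (alpha m D1)) by apply exp_pos.
  assert (Hu := exp_gt_1 l ltac:(lra)).
  assert (Hx := exp_pos (- l)).
  assert (HS := is_series_unique _ _
    (gen_diff m D1 (exp (- l)) (proj1 hpar) ltac:(lra) ltac:(nra))).
  rewrite (Series_ext _ (fun j => - D2 *
    ((coef m D1 (S (S j)) - coef m D1 (S j)) * exp (- l) ^ S j)))
    by (intros j; rewrite Hpow; apply Rmult_assoc).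
  rewrite Series_scal_l, HS, HH.
  (* With [H l^alpha = reg l], this is [E l = (e^l - 1) (reg l - D2 gen (e^(-l)))] multiplied
     out. *)
  unfold reg; rewrite exp_Ropp; field; lra.
(* The majorant is [D2] times the coefficient bound [D1^(-(j + 2))] times [(e^(-1) D1)^(j + 1)]. *)
- apply CVU_dom_M_test with (fun j => D2 * / D1 * exp (-1) * exp (-1) ^ j).
  + exists (D2 * / D1 * exp (-1) * / (1 - exp (-1))).
    apply (is_series_scal (D2 * / D1 * exp (-1)) (fun j => exp (-1) ^ j)).
    apply is_series_geom.
    rewrite Rabs_pos_eq; lra.
  + intros j l Hl; specialize (HL l Hl); rewrite Hpow.
    destruct hpar as (_ & _ & HD2 & _).
    assert (Hx := exp_pos (- l)).
    assert (Hxj : 0 <= exp (- l) ^ S j <= (exp (-1) * D1) ^ S j)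
      by (split; [apply pow_le|apply pow_incr]; lra).
    assert (HB : / D1 >= 1)
      by (apply Rle_ge; rewrite <- Rinv_1; apply Rinv_le_contravar; lra).
    assert (B1 := coef_fuel_bound m D1 (S j) (S j) ltac:(lra)).
    assert (B2 := coef_fuel_bound m D1 (S (S j)) (S (S j)) ltac:(lra)).
    fold (coef m D1 (S j)) in B1; fold (coef m D1 (S (S j))) in B2.
    (* Both coefficients lie in [[0, B]], hence their difference is at most [B] in absolute
       value. *)
    set (B := (/ D1) ^ S (S j)) in *.
    assert (B0 : (/ D1) ^ S j <= B)
      by (apply Rle_pow; [lra|lia]).
    rewrite Rabs_mult, Rabs_mult, Rabs_Ropp, (Rabs_pos_eq D2) by easy.
    rewrite (Rabs_pos_eq (exp (- l) ^ S j)) by easy.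
    replace (D2 * / D1 * exp (-1) * exp (-1) ^ j)
      with (D2 * B * (exp (-1) * D1) ^ S j).
    * apply Rmult_le_compat; try easy.
      -- apply Rmult_le_pos; [easy|apply Rabs_pos].
      -- apply Rmult_le_compat_l; [easy|apply Rabs_le; lra].
    * unfold B; rewrite Rpow_mult_distr, pow_inv; simpl.
      assert (0 < D1 ^ j) by (apply pow_lt; lra).
      field; lra.
Qed.
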